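(* Let $d$ and $k$ be positive integers with $k\leq 2d-1$. Then there is a subset of the generator set $G_1(d,2)$ whose Minkowski sum $\sum_{v\in T}[0,1]v$ (for that subset $T\subseteq G_1(d,2)$) is, up to translation, a lattice $(d,k)$-polytope with edge-diameter $\lfloor (k+1)d/2\rfloor$. Consequently, for $k\leq 2d-1$, $\delta(d,k)\geq \lfloor (k+1)d/2\rfloor$. For instance, $H_1^+(d,2)$ is a lattice $(d,d)$-polytope with edge-diameter $\binom{d+1}{2}$, and $H_1(d,2)$ is, up to translation, a lattice $(d,2d-1)$-polytope with edge-diameter $d^2$.
   Context: A lattice $(d,k)$-polytope is a full-dimensional polytope in $\mathbb{R}^d$ that is the convex hull of points all drawn from $\{0,1,\dots,k\}^d$. The (edge-)diameter of a polytope is the diameter of its graph formed by vertices and edges. $\delta(d,k)$ denotes the maximum edge-diameter over all lattice $(d,k)$-polytopes. For $v\in\mathbb{Z}^d$, $\gcd(v)$ is the largest integer dividing all entries of $v$, and $v\succ 0$ means the first nonzero coordinate of $v$ is positive. Let $G_1(d,2)=\{v\in\mathbb{Z}^d : \|v\|_1\leq 2,\ \gcd(v)=1,\ v\succ 0\}$ (i.e. the unit vectors $e_i$, and $e_i+e_j$, $e_i-e_j$ for $i<j$), and $H_1(d,2)=\sum_{v\in G_1(d,2)}[0,1]v$ (Minkowski sum of the segments $[0,v]$). Let $H_1^+(d,2)=\sum[0,1]\{v\in\mathbb{Z}_{+}^d : \|v\|_1\leq 2,\ \gcd(v)=1\}$, where $\mathbb{Z}_+=\{0,1,2,\dots\}$.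 *)

(* Defs.v *)
From HB Require Import structures.
From mathcomp Require Import all_boot all_order all_algebra.
From mathcomp Require Import reals.
Set Implicit Arguments. Unset Strict Implicit. Unset Printing Implicit Defensive.
Import Order.TTheory GRing.Theory Num.Theory.
Local Open Scope ring_scope.

Definition pt (R : realType) (d : nat) := 'I_d -> R.

Section Geometry.
Variables (R : realType) (d : nat).

Definition dot (c x : pt R d) : R := \sum_(i < d) c i * x i.

Definition eqpt (x y : pt R d) : Prop := forall i, x i = y i.

Definition ivec := {ffun 'I_d -> int}.

Definition ivec_gcd (v : ivec) : nat := \big[gcdn/0%N]_(i < d) `|v i|%N.
Definition ivec_norm1 (v : ivec) : nat := (\sum_(i < d) `|v i|)%N.
Definition ivec_lexpos (v : ivec) : Prop :=
  exists i : 'I_d, 0 < v i /\ forall j : 'I_d, (j < i)%N -> v j = 0.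

Definition inG1 (v : ivec) : Prop :=
  (ivec_norm1 v <= 2)%N /\ ivec_gcd v = 1%N /\ ivec_lexpos v.
Definition inG1plus (v : ivec) : Prop :=
  (forall i, 0 <= v i) /\ (ivec_norm1 v <= 2)%N /\ ivec_gcd v = 1%N.

Definition zonotope (T : seq ivec) : pt R d -> Prop := fun x =>
  exists lam : 'I_(size T) -> R, (forall j, 0 <= lam j <= 1) /\
    forall i, x i = \sum_(j < size T) lam j * ((nth [ffun=> 0] T j) i)%:~R.

Definition translate (P : pt R d -> Prop) (t : pt R d) : pt R d -> Prop :=
  fun x => P (fun i => x i - t i).

Definition conv_hull (s : seq ivec) : pt R d -> Prop := fun x =>
  exists mu : 'I_(size s) -> R, (forall j, 0 <= mu j) /\
    \sum_(j < size s) mu j = 1 /\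
    forall i, x i = \sum_(j < size s) mu j * ((nth [ffun=> 0] s j) i)%:~R.

Definition full_dim (P : pt R d -> Prop) : Prop :=
  forall c : pt R d, (exists a, forall x, P x -> dot c x = a) -> forall i, c i = 0.

Definition lattice_polytope (k : nat) (P : pt R d -> Prop) : Prop :=
  full_dim P /\
  exists s : seq ivec,
    (forall v, v \in s -> forall i, 0 <= v i <= k%:Z) /\
    (forall x, P x <-> conv_hull s x).

Definition face (P : pt R d -> Prop) (c : pt R d) : pt R d -> Prop :=
  fun y => P y /\ forall z, P z -> dot c z <= dot c y.

Definition segment (u v : pt R d) : pt R d -> Prop := fun x =>
  exists th : R, 0 <= th <= 1 /\ forall i, x i = (1 - th) * u i + th * v i.

Definition is_vertex (P : pt R d -> Prop) (x : pt R d) : Prop :=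
  exists c, forall y, face P c y <-> eqpt y x.

Definition is_edge (P : pt R d -> Prop) (u v : pt R d) : Prop :=
  is_vertex P u /\ is_vertex P v /\ ~ eqpt u v /\
  exists c, forall y, face P c y <-> segment u v y.

Fixpoint walk (P : pt R d -> Prop) (u v : pt R d) (n : nat) : Prop :=
  match n with
  | 0%N => eqpt u v
  | n'.+1 => exists w, is_edge P u w /\ walk P w v n'
  end.

Definition edge_diameter (P : pt R d -> Prop) (D : nat) : Prop :=
  (forall u v, is_vertex P u -> is_vertex P v ->
     exists n, (n <= D)%N /\ walk P u v n) /\
  (exists u v, is_vertex P u /\ is_vertex P v /\
     forall n, walk P u v n -> (D <= n)%N).

End Geometry.

(* Main.v *)
(** A zonotope with pairwise non-parallel generators v_1, ..., v_n has edge-diameter n.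
    Its vertices correspond to the sign vectors of generic linear functionals on the
    generators, and two adjacent vertices differ in exactly one sign, so antipodal
    vertices are at distance at least n. Conversely, moving one functional to a generic
    perturbation of another changes the signs one at a time.

    The generators in G_1(d,2) are indexed by the ordered pairs (i, j) of coordinates:
    (i, i) stands for e_i, and (i, j), (j, i) for e_i + e_j, e_i - e_j. A set of pairs
    containing the diagonal gives a full-dimensional zonotope, whose width in direction l
    is the out-degree plus the in-degree of l, minus one. For k - 1 = 2a + b with b <= 1,
    a circulant digraph with a shifts plus, if b = 1, a maximum matching of {0, ..., d-1}
    attains the largest number of pairs. *)
Require Import Defs.
From HB Require Import structures.
From mathcomp Require Import all_boot all_order all_algebra.
From mathcomp Require Import reals boolp zify ring lra.
Set Implicit Arguments.
Unset Strict Implicit.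
Unset Printing Implicit Defensive.
Import Order.TTheory GRing.Theory Num.Theory.
Local Open Scope ring_scope.

(** * Generic linear functionals *)

(** The sign of [f i] survives as soon as [e * |g i| < |f i|]. The sum of the ratios [|g i| / |f i|]
    stands in for their maximum, and adding 1 makes it invertible. *)
Lemma small_perturbation (R : realFieldType) (I : finType) (f g : I -> R) :
  exists e, 0 < e /\ forall i, f i != 0 -> 0 < f i * (f i + e * g i).
Proof.
pose S := \sum_(i | f i != 0) `|g i| / `|f i|.
have S0 : 0 <= S by apply: sumr_ge0 => i _; rewrite divr_ge0.
exists (1 + S)^-1; split=> [|i fi]; first by rewrite invr_gt0; lra.
have gS : `|g i| / `|f i| <= S.
  by rewrite /S (bigD1 i) //= lerDl sumr_ge0 // => j _; rewrite divr_ge0.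
have f0 : 0 < `|f i| by rewrite normr_gt0.
have {gS} gS : `|g i| <= S * `|f i| by rewrite -ler_pdivrMr.
have h : (1 + S)^-1 * `|g i| < `|f i|.
  by rewrite mulrC ltr_pdivrMr; [nra | lra].
have e0 : 0 < (1 + S)^-1 by rewrite invr_gt0; lra.
move: (1 + S)^-1 e0 h => e e0 h.
have h2 : - (f i * g i) <= `|f i| * `|g i| by rewrite -normrM -normrN ler_norm.
have h3 : `|f i| * `|f i| = f i * f i.
  by rewrite -normrM ger0_norm // -expr2 sqr_ge0.
have : e * - (f i * g i) <= e * (`|f i| * `|g i|) by rewrite ler_pM2l.
have : `|f i| * (e * `|g i|) < `|f i| * `|f i| by rewrite ltr_pM2l.
rewrite h3; lra.
Qed.

Section Dot.
Variables (R : realType) (d : nat).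
Implicit Types (c w x : pt R d).

Lemma dot_axpy c w a b x :
  dot (fun l => a * c l + b * w l) x = a * dot c x + b * dot w x.
Proof.
by rewrite /dot !mulr_sumr -big_split /=; apply: eq_bigr => l _; ring.
Qed.

Lemma dotC c x : dot c x = dot x c.
Proof. by apply: eq_bigr => l _; rewrite mulrC. Qed.

Lemma dot_self_gt0 c : (exists l, c l != 0) -> 0 < dot c c.
Proof.
case=> l cl; rewrite /dot (bigD1 l) //= ltr_pwDl //.
  by rewrite -expr2 exprn_even_gt0.
by apply: sumr_ge0 => i _; rewrite -expr2 sqr_ge0.
Qed.

(** Induction on the number of [W i] orthogonal to [c]: adding a small multiple of one such [W i] to
    [c] makes the product with it positive, since [dot (W i) (W i)] is, and keeps every sign already
    decided. *)
Lemma generic_functional (I : finType) (W : I -> pt R d) c :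
  (forall i, exists l, W i l != 0) ->
  exists c', (forall i, dot c' (W i) != 0) /\
    (forall i, dot c (W i) != 0 -> 0 < dot c (W i) * dot c' (W i)).
Proof.
move=> Wn0; move: {2}#|_| (leqnn #|[set i | dot c (W i) == 0]|) => m.
elim: m c => [|m IH] c Hm.
  have h i : dot c (W i) != 0.
    apply/negP => h; move: Hm; rewrite leqn0 cards_eq0 => /eqP/setP/(_ i).
    by rewrite !inE h.
  by exists c; split=> // i hi; rewrite -expr2 exprn_even_gt0.
have [/existsP[i /eqP ci0]|/existsPn h] := boolP [exists i, dot c (W i) == 0]; last first.
  by exists c; split=> // i hi; rewrite -expr2 exprn_even_gt0.
have [e [e0 He]] :=
  small_perturbation (fun j => dot c (W j)) (fun j => dot (W i) (W j)).
pose c2 : pt R d := fun l => 1 * c l + e * W i l.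
have c2E j : dot c2 (W j) = dot c (W j) + e * dot (W i) (W j).
  by rewrite /c2 dot_axpy mul1r.
have [|c' [g s]] := IH c2.
  rewrite -ltnS; apply: leq_trans Hm; apply: proper_card.
  apply/properP; split.
    apply/subsetP=> j; rewrite !inE c2E => /eqP h.
    by apply: contraT => /He; rewrite h mulr0 ltxx.
  exists i; rewrite !inE ?ci0 // c2E ci0 add0r mulf_neq0 ?gt_eqF //.
  exact: dot_self_gt0.
exists c'; split=> // j hj.
have h := He _ hj; rewrite -c2E in h.
have h2 : dot c2 (W j) != 0 by apply: contraTneq h => ->; rewrite mulr0 ltxx.
have := s _ h2; nra.
Qed.

End Dot.

(** * The graph of a zonotope *)

Section ZonotopeGraph.
Variables (R : realType) (d n : nat) (v : 'I_n -> pt R d) (t : pt R d).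
Variable P : pt R d -> Prop.

Let comb (lam : 'I_n -> R) : pt R d := fun i => t i + \sum_j lam j * v j i.
Let box (lam : 'I_n -> R) := forall j, 0 <= lam j <= 1.

Hypothesis P_comb : forall x, P x <-> exists lam, box lam /\ x = comb lam.
Hypothesis v_neq0 : forall j, exists l, v j l != 0.
Hypothesis v_indep : forall i j, i != j -> forall a b,
  (forall l, a * v i l + b * v j l = 0) -> a = 0 /\ b = 0.

(** A zero product counts as negative, so [vert c] maximizes [c] over [P] even when [c] is not
    generic. *)
Let sgn (c : pt R d) (j : 'I_n) : bool := 0 < dot c (v j).
Let generic (c : pt R d) := forall j, dot c (v j) != 0.
Let vert c := comb (fun j => (sgn c j)%:R).

Let box_sgn c : box (fun j => (sgn c j)%:R).
Proof. by move=> j; case: (sgn c j); rewrite /= ?lexx ?ler01. Qed.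

Let P_of_comb lam : box lam -> P (comb lam).
Proof. by move=> h; apply/P_comb; exists lam. Qed.

Let eq_comb l1 l2 : l1 =1 l2 -> comb l1 = comb l2.
Proof.
move=> h; apply: funext => i; rewrite /comb; congr (_ + _).
by apply: eq_bigr => j _; rewrite h.
Qed.

Let dot_comb c lam : dot c (comb lam) = dot c t + \sum_j lam j * dot c (v j).
Proof.
rewrite /dot /comb; under eq_bigr do rewrite mulrDr.
rewrite big_split /=; congr (_ + _).
under eq_bigr do rewrite mulr_sumr.
rewrite exchange_big /=; apply: eq_bigr => j _.
by rewrite mulr_sumr; apply: eq_bigr => i _; ring.
Qed.

Let compat c (lam : 'I_n -> R) :=
  forall j, (0 < dot c (v j) -> lam j = 1) /\ (dot c (v j) < 0 -> lam j = 0).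

(** A functional is maximized over the box one coefficient at a time. Comparison with [vert c] gives
    nonnegative gaps of nonpositive total, so every gap vanishes. *)
Let face_comb c lam : box lam -> face P c (comb lam) <-> compat c lam.
Proof.
move=> lb; split=> [[_ h] j|h].
  have := h _ (P_of_comb (box_sgn c)); rewrite !dot_comb lerD2l => {}h.
  have F i : 0 <= (sgn c i)%:R * dot c (v i) - lam i * dot c (v i).
    rewrite /sgn; have /andP[l0 l1] := lb i.
    by case: ltP => /= s; nra.
  have : \sum_i ((sgn c i)%:R * dot c (v i) - lam i * dot c (v i)) == 0.
    rewrite eq_le sumr_ge0 // andbT sumrB subr_le0 //.
  rewrite psumr_eq0 // => /allP/(_ j (mem_index_enum _))/eqP.
  rewrite /sgn; case: ltP => /= s E; split=> // s'.
  - have : (1 - lam j) * dot c (v j) = 0 by lra.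
    by move/eqP; rewrite mulf_eq0 (gt_eqF s) orbF => /eqP; lra.
  - by move: s'; rewrite ltNge ltW.
  - have /eqP : lam j * dot c (v j) = 0 by lra.
    by rewrite mulf_eq0 (lt_eqF s') orbF => /eqP.
split; first exact: P_of_comb.
move=> z /P_comb [mu [mb ->]]; rewrite !dot_comb lerD2l; apply: ler_sum => j _.
have [h1 h2] := h j; have /andP[m0 m1] := mb j.
have [s|s|->] := ltgtP (dot c (v j)) 0; last by rewrite !mulr0.
- rewrite h2 //; nra.
- rewrite h1 //; nra.
Qed.

Let compat_sgn c : compat c (fun j => (sgn c j)%:R).
Proof.
move=> j; rewrite /sgn; split=> h; first by rewrite h.
by rewrite ltNge ltW.
Qed.

Let compat_generic c lam : generic c -> compat c lam -> comb lam = vert c.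
Proof.
move=> g h; apply: eq_comb => j; have [h1 h2] := h j.
rewrite /sgn; have := g j; by case: ltgtP => // s _ /=; first [exact: h1 | exact: h2].
Qed.

Let vert_vertex c : generic c -> is_vertex P (vert c).
Proof.
move=> g; exists c => y; split=> [fy|/funext ->].
  have [/P_comb [lam [lb yE]] _] := fy; rewrite yE in fy *.
  by move/(face_comb _ lb): fy => /(compat_generic g) ->.
apply/face_comb; [exact: box_sgn|exact: compat_sgn].
Qed.

Let flip (lam : 'I_n -> R) j x : 'I_n -> R :=
  fun i => if i == j then x else lam i.

Let comb_flip lam j x l : comb (flip lam j x) l = comb lam l + (x - lam j) * v j l.
Proof.
rewrite /comb /flip -addrA; congr (_ + _).
rewrite (bigD1 j) //= eqxx (bigD1 j (F := fun i => lam i * v i l)) //=.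
rewrite (eq_bigr (fun i => lam i * v i l)); first by ring.
by move=> i /negPf ->.
Qed.

Let face_flip c lam j x : box lam -> 0 <= x <= 1 -> compat c lam ->
  dot c (v j) = 0 -> face P c (comb (flip lam j x)).
Proof.
move=> lb xb h cj; apply/face_comb => i; rewrite /flip.
  by case: eqP => _ //; apply: lb.
by case: eqP => [->|_]; [rewrite cj ltxx | exact: h].
Qed.

(** A functional that exposes a vertex is already generic: if it vanished on [v j], switching the
    j-th coefficient would give a second maximizer. *)
Let vertexE x : is_vertex P x -> exists c, generic c /\ x = vert c.
Proof.
case=> c Hc; exists c.
have /Hc/funext vx : face P c (vert c).
  by apply/face_comb; [exact: box_sgn|exact: compat_sgn].
split=> // j; apply/negP => /eqP cj0.
have [l vl] := v_neq0 j.
pose y := ~~ sgn c j.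
have /Hc/(_ l) : face P c (comb (flip (fun j => (sgn c j)%:R) j y%:R)).
  apply: face_flip => //.
  by case: y; rewrite /= ?lexx ?ler01.
rewrite comb_flip -vx /vert /y => /eqP; rewrite -subr_eq0 addrAC subrr add0r mulf_eq0.
rewrite (negPf vl) orbF; case: (sgn c j) => /=.
  by rewrite sub0r oppr_eq0 oner_eq0.
by rewrite subr0 oner_eq0.
Qed.

Let diffs c c' := [set j | sgn c j != sgn c' j].

Let same_sgn c c' j : 0 < dot c (v j) * dot c' (v j) -> sgn c j = sgn c' j.
Proof. by rewrite /sgn => h; apply/idP/idP; nra. Qed.

Let comb_mix (th : R) l1 l2 i : (1 - th) * comb l1 i + th * comb l2 i =
  comb (fun j => (1 - th) * l1 j + th * l2 j) i.
Proof.
rewrite /comb !mulrDr !mulr_sumr addrACA -big_split /=; congr (_ + _); first by ring.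
by apply: eq_bigr => j _; ring.
Qed.

(** On the face of [e] only the j-th coefficient is free, so this face is a translate of the segment
    along [v j]. *)
Let edge_flip e c c' j : generic c -> generic c' -> dot e (v j) = 0 ->
  (forall i, i != j -> 0 < dot e (v i) * dot c (v i)) ->
  (forall i, i != j -> 0 < dot e (v i) * dot c' (v i)) ->
  sgn c j != sgn c' j -> is_edge P (vert c) (vert c').
Proof.
move=> gc gc' ej ec ec' sj; split; first exact: vert_vertex.
split; first exact: vert_vertex.
have scc' i : i != j -> sgn c' i = sgn c i.
  by move=> ij; rewrite -(same_sgn (ec _ ij)) -(same_sgn (ec' _ ij)).
(* The free coefficient runs down from 1 or up from 0, according to the sign of [c] on [v j]. *)
have mixE th : (fun i => (1 - th) * (sgn c i)%:R + th * (sgn c' i)%:R) =1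
  flip (fun i => (sgn c i)%:R) j (if sgn c j then 1 - th else th).
  move=> i; rewrite /flip; case: eqVneq => [->|ij]; last by rewrite scc' //; ring.
  by move: sj; case: (sgn c j); case: (sgn c' j) => // _ /=; ring.
have ce : compat e (fun i => (sgn c i)%:R).
  move=> i; have [->|ij] := eqVneq i j; first by rewrite ej ltxx.
  rewrite -(same_sgn (ec _ ij)); exact: compat_sgn.
split.
  move=> E; have [l vl] := v_neq0 j.
  have := E l; have := comb_mix 1 (fun i => (sgn c i)%:R) (fun i => (sgn c' i)%:R) l.
  rewrite (eq_comb (mixE 1)) comb_flip -/(vert c) -/(vert c') => h h'.
  have /eqP : ((if sgn c j then 1 - 1 else 1) - (sgn c j)%:R) * v j l = 0 by lra.
  rewrite mulf_eq0 (negPf vl) orbF; case: (sgn c j) => /=.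
    by rewrite subrr sub0r oppr_eq0 oner_eq0.
  by rewrite subr0 oner_eq0.
exists e => y; split=> [fy|[th [thb /funext ->]]].
  have [/P_comb [lam [lb yE]] _] := fy; rewrite {}yE in fy *.
  move/(face_comb _ lb): fy => fy.
  pose th := if sgn c j then 1 - lam j else lam j.
  have lbj := lb j; exists th; split; first by rewrite /th; case: (sgn c j) => //; lra.
  move=> i; rewrite comb_mix; congr (comb _ _); apply: funext => m.
  rewrite mixE /flip /th; case: eqVneq => [->|mj].
    by case: (sgn c j) => //; ring.
  have [h1 h2] := fy m; have := ec _ mj.
  rewrite -(same_sgn (ec _ mj)) /sgn => h.
  have : dot e (v m) != 0 by apply: contraTneq h => ->; rewrite mul0r ltxx.
  by case: ltgtP => // s _; first [exact: h1 | exact: h2].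
have -> : (fun i => (1 - th) * vert c i + th * vert c' i) =
  comb (flip (fun i => (sgn c i)%:R) j (if sgn c j then 1 - th else th)).
  by apply: funext => i; rewrite comb_mix (eq_comb (mixE th)).
apply: face_flip => //.
by case: (sgn c j) => //; lra.
Qed.

(* On a segment from c to a generic perturbation of c', the generators change sign
   one at a time; the first change yields the edge. *)
Let edge_towards c c' : generic c -> generic c' -> diffs c c' != set0 ->
  exists c2, generic c2 /\ is_edge P (vert c) (vert c2) /\
    (#|diffs c2 c'| < #|diffs c c'|)%N.
Proof.
move=> gc gc' /set0Pn [j0 Dj0].
(* Besides the generators, [c1] has to be nonzero on the combinations of [v i] and [v j] orthogonal
   to [c]: this keeps two generators from changing sign at the same moment. Diagonal pairs carry a
   harmless nonzero vector. *)
pose W (k : 'I_n + 'I_n * 'I_n) : pt R d := match k with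
  | inl j => v j
  | inr (i, j) => if i == j then v i else
      fun l => dot c (v i) * v j l + (- dot c (v j)) * v i l end.
have Wn0 k : exists l, W k l != 0.
  case: k => [j|[i j]] /=; first exact: v_neq0.
  case: eqVneq => [_|ij]; first exact: v_neq0.
  apply: contrapT => h; have [] := v_indep ij (a := - dot c (v j)) (b := dot c (v i)).
    move=> l; rewrite addrC; apply/eqP; apply: contraT => hl.
    by case: h; exists l.
  by move=> _ /eqP; apply/negP; exact: gc.
have [c1 [g1 s1]] := generic_functional c' Wn0.
pose a i := dot c (v i); pose b i := dot c1 (v i).
have bc i : 0 < dot c' (v i) * b i by apply: (s1 (inl i)); exact: gc'.
have ab i j : i != j -> a i * b j != a j * b i.
  move=> ij; have := g1 (inr (i, j)); rewrite /= (negPf ij) dotC dot_axpy.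
  by rewrite -[a i * _ == _]subr_eq0 mulNr !(dotC _ c1).
have a0 i : a i != 0 := gc i.
have b0 i : b i != 0 := g1 (inl i).
have Dab i : i \in diffs c c' -> a i * b i < 0.
  rewrite inE (same_sgn (bc i)) => h; rewrite lt_neqAle mulf_neq0 //= leNgt.
  by apply/negP => /same_sgn E; rewrite E eqxx in h.
have nDab i : i \notin diffs c c' -> 0 < a i * b i.
  rewrite inE negbK (same_sgn (bc i)) /sgn -/(a i) -/(b i) => /eqP E.
  rewrite lt_neqAle eq_sym mulf_neq0 //= leNgt; apply/negP.
  by case: (ltP 0 (a i)) E => ha; case: (ltP 0 (b i)) => hb // _; nra.
(* The parameter t at which [(1 - t) * a i + t * b i] vanishes, used for [i] in [diffs c c'], where
   the denominator is nonzero. *)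
pose tm i := a i / (a i - b i).
have amb i : i \in diffs c c' -> 0 < a i * (a i - b i).
  move=> /Dab; nra.
have ambn i : i \in diffs c c' -> a i - b i != 0.
  by move=> /amb h; apply: contraTneq h => ->; rewrite mulr0 ltxx.
have tmE i : i \in diffs c c' -> a i = tm i * (a i - b i).
  by move=> /ambn h; rewrite /tm mulfVK.
case: (arg_minP tm Dj0) => j; rewrite -[X in is_true X]/(j \in _) => Dj jmin.
have tj : 0 < tm j < 1.
  have := amb j Dj; have := Dab j Dj; have := tmE j Dj.
  move: (tm j) => x E h1 h2; rewrite {1}E in h2.
  have h3 : b j = (x - 1) * (a j - b j) by lra.
  have h4 := ambn j Dj; move: (a j - b j) E h2 h3 h4 h1 => y -> h2 -> h4 h1.
  have : 0 < y ^+ 2 by rewrite exprn_even_gt0.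
  by nra.
pose e : pt R d := fun l => (1 - tm j) * c l + tm j * c1 l.
have eE i : dot e (v i) = (1 - tm j) * a i + tm j * b i by rewrite /e dot_axpy.
have ej : dot e (v j) = 0 by rewrite eE; have := tmE j Dj; lra.
have ei i : i != j -> 0 < dot e (v i) * a i.
  move=> ij; rewrite eE; have [Di|/nDab h] := boolP (i \in diffs c c'); last first.
    have : 0 < a i ^+ 2 by rewrite exprn_even_gt0 //= a0.
    nra.
  have lt : tm j < tm i.
    (* A tie would give [a i * b j = a j * b i], which the choice of [c1] excludes. *)
    rewrite lt_neqAle jmin // andbT; apply: contraNneq (ab _ _ ij) => E.
    have := tmE i Di; have := tmE j Dj; rewrite E => E1 E2; apply/eqP.
    have E3 : b i * tm i = (tm i - 1) * a i by lra.
    have E4 : b j * tm i = (tm i - 1) * a j by lra.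
    have ti : tm i != 0 by rewrite -E gt_eqF //; case/andP: tj.
    apply: (mulIf ti); rewrite -!mulrA E3 E4; ring.
  have -> : (1 - tm j) * a i + tm j * b i = (tm i - tm j) * (a i - b i).
    by have := tmE i Di; lra.
  by have := amb i Di; nra.
(* Since [e] vanishes on [v j], a small step towards [c'] gives this generator its final sign and
   keeps the other signs. *)
have [eps [eps0 He]] :=
  small_perturbation (fun i => dot e (v i)) (fun i => dot c' (v i)).
pose c2 : pt R d := fun l => 1 * e l + eps * c' l.
have c2E i : dot c2 (v i) = dot e (v i) + eps * dot c' (v i).
  by rewrite /c2 dot_axpy mul1r.
have en0 i : i != j -> dot e (v i) != 0.
  by move=> /ei h; apply: contraTneq h => ->; rewrite mul0r ltxx.
have ec2 i : i != j -> 0 < dot e (v i) * dot c2 (v i).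
  by move=> ij; rewrite c2E; apply: He; exact: en0.
have c2j : dot c2 (v j) = eps * dot c' (v j) by rewrite c2E ej add0r.
have g2 : generic c2.
  move=> i; have [->|/ec2 h] := eqVneq i j; first by
    rewrite c2j mulf_neq0 ?(gt_eqF eps0) //; exact: gc'.
  by apply: contraTneq h => ->; rewrite mulr0 ltxx.
have s2j : sgn c2 j = sgn c' j by rewrite /sgn c2j pmulr_rgt0.
exists c2; split=> //; split.
  apply: (edge_flip (e := e) (j := j)) => //; by move: Dj; rewrite inE s2j.
apply: proper_card; apply/properP; split; last by exists j; rewrite // inE s2j eqxx.
apply/subsetP => i; rewrite !inE; have [->|ij] := eqVneq i j; first by rewrite s2j eqxx.
by rewrite -(same_sgn (ei _ ij)) -(same_sgn (ec2 _ ij)).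
Qed.

Let diffs0_vert c c' : diffs c c' = set0 -> vert c = vert c'.
Proof.
move=> D; apply: eq_comb => j; move/setP/(_ j): D; rewrite !inE => /negbT.
by rewrite negbK => /eqP ->.
Qed.

Let walk_upper m c c' : generic c -> generic c' -> (#|diffs c c'| <= m)%N ->
  exists p, (p <= m)%N /\ walk P (vert c) (vert c') p.
Proof.
elim: m c => [|m IH] c gc gc' Dm.
  exists 0%N; split=> //; move: Dm; rewrite leqn0 cards_eq0 => /eqP/diffs0_vert E.
  by rewrite /= E.
have [/eqP/diffs0_vert E|D0] := boolP (diffs c c' == set0).
  by exists 0%N; rewrite /= E.
have [c2 [g2 [E lt]]] := edge_towards gc gc' D0.
have [|p [pm w]] := IH c2 g2 gc'; first by rewrite -ltnS (leq_trans lt).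
by exists p.+1; split=> //; exists (vert c2).
Qed.

Let face_vert_sgn e c : generic c -> face P e (vert c) ->
  forall j, dot e (v j) != 0 -> sgn c j = sgn e j.
Proof.
move=> gc /(face_comb _ (box_sgn c)) h j ej; have [h1 h2] := h j.
rewrite [RHS]/sgn; move: ej h1 h2; case: ltgtP => // _ _ h1 h2.
  by apply/negPn/negP => /negPf s; move/eqP: (h1 isT); rewrite s /= eq_sym oner_eq0.
by apply/negbTE/negP => s; move/eqP: (h2 isT); rewrite s /= oner_eq0.
Qed.

Let vert_inj c c' : generic c -> generic c' -> vert c = vert c' -> sgn c =1 sgn c'.
Proof.
move=> gc gc' E j; apply/esym; apply: (@face_vert_sgn c c') => //.
by rewrite -E; apply/face_comb; [exact: box_sgn|exact: compat_sgn].
Qed.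

(** Where the signs at the two ends differ, the functional exposing the edge vanishes on [v j];
    flipping that coefficient stays on the edge, so [v j] is parallel to it. Two such generators
    would be parallel to each other. *)
Let edge_diffs c c' : generic c -> generic c' ->
  is_edge P (vert c) (vert c') -> (#|diffs c c'| <= 1)%N.
Proof.
move=> gc gc' [_ [_ [_ [e He]]]].
have fc : face P e (vert c).
  by apply/He; exists 0; rewrite lexx ler01; split=> // i; ring.
have fc' : face P e (vert c').
  by apply/He; exists 1; rewrite lexx ler01; split=> // i; ring.
have De j : j \in diffs c c' -> dot e (v j) = 0.
  rewrite inE => h; apply/eqP; apply: contraT => ej.
  by rewrite (face_vert_sgn gc fc ej) (face_vert_sgn gc' fc' ej) eqxx in h.
have par j : j \in diffs c c' -> exists a, a != 0 /\
    forall l, v j l = a * (vert c' l - vert c l).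
  move=> /De ej.
  have : face P e (comb (flip (fun i => (sgn c i)%:R) j (~~ sgn c j)%:R)).
    apply: face_flip => //.
      by case: (sgn c j); rewrite /= ?lexx ?ler01.
    by apply/face_comb => //; exact: box_sgn.
  move/He => [th [_ h]].
  have {}h l : ((~~ sgn c j)%:R - (sgn c j)%:R) * v j l = th * (vert c' l - vert c l).
    by have := h l; rewrite comb_flip -/(vert c); lra.
  have [l vl] := v_neq0 j.
  have hE : exists a, forall l, v j l = a * (vert c' l - vert c l).
    case: (sgn c j) h => /= h; [exists (- th)|exists th] => m; have := h m; lra.
  case: hE => a ha; exists a; split=> //.
  by apply: contraNneq vl => a0; rewrite ha a0 mul0r.
rewrite leqNgt; apply/negP => /card_gt1P [i [j [Di Dj ij]]].
have [x [x0 hx]] := par _ Di; have [y [y0 hy]] := par _ Dj.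
have [|y00 _] := v_indep ij (a := y) (b := - x).
  by move=> l; rewrite hx hy; ring.
by rewrite y00 eqxx in y0.
Qed.

(** Sets of sign differences obey a triangle inequality, and each edge accounts for at most one
    difference. *)
Let walk_lower m c c' : generic c -> generic c' ->
  walk P (vert c) (vert c') m -> (#|diffs c c'| <= m)%N.
Proof.
elim: m c => [|m IH] c gc gc' /=.
  move/funext/(vert_inj gc gc') => E; rewrite leqn0 cards_eq0; apply/eqP/setP => j.
  by rewrite !inE E eqxx.
case=> w [E W]; have [_ [/vertexE [c2 [g2 wE]] _]] := E; rewrite {}wE in E W.
have h1 := edge_diffs gc g2 E; have h2 := IH _ g2 gc' W.
apply: (@leq_trans #|diffs c c2 :|: diffs c2 c'|).
  apply: subset_leq_card; apply/subsetP => j; rewrite !inE.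
  by case: (sgn c j); case: (sgn c2 j); case: (sgn c' j).
by apply: leq_trans (leq_card_setU _ _) _; rewrite -add1n leq_add.
Qed.

Lemma edge_diameter_zonotope : edge_diameter P n.
Proof.
split=> [x y /vertexE [c [gc ->]] /vertexE [c' [gc' ->]]|].
  by apply: walk_upper => //; rewrite -[leqRHS]card_ord max_card.
have [c [gc _]] := generic_functional (fun=> 0) v_neq0.
(* The opposite functional, in the shape that [dot_axpy] evaluates; its vertex is antipodal. *)
pose c' : pt R d := fun l => (-1) * c l + 0 * c l.
have c'E j : dot c' (v j) = - dot c (v j) by rewrite /c' dot_axpy; ring.
have gc' : generic c' by move=> j; rewrite c'E oppr_eq0.
exists (vert c), (vert c'); split; first exact: vert_vertex.
split=> [|m /(walk_lower gc gc')]; first exact: vert_vertex.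
suff -> : diffs c c' = setT by rewrite cardsT card_ord.
apply/setP => j; rewrite !inE /sgn c'E oppr_gt0.
by have := gc j; case: ltgtP.
Qed.

End ZonotopeGraph.

(** * Zonotopes as lattice polytopes *)

(* [mu S] is the probability of S when each j is kept independently with probability [lam j]. *)
Lemma cube_weights (R : realDomainType) (I : finType) (lam : I -> R) :
  (forall j, 0 <= lam j <= 1) ->
  exists mu : {set I} -> R, [/\ forall S, 0 <= mu S, \sum_S mu S = 1 &
    forall j, \sum_S mu S * (j \in S)%:R = lam j].
Proof.
have distr (F G : I -> R) : \sum_(S : {set I}) \prod_j (if j \in S then F j else G j) =
    \prod_j (F j + G j).
  by rewrite bigA_distr; apply: eq_bigl => S; rewrite inE.
move=> lb; exists (fun S : {set I} => \prod_j (if j \in S then lam j else 1 - lam j)); split.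
- move=> S; apply: prodr_ge0 => j _; have := lb j; case: ifP => _; lra.
- by rewrite distr; apply: big1 => j _; ring.
move=> j.
(* Discarding the subsets that omit [j] amounts to replacing [1 - lam j] by 0 in the product. *)
transitivity (\prod_l (lam l + (if l == j then 0 else 1 - lam l))).
  rewrite -distr; apply: eq_bigr => S _.
  rewrite (bigD1 j) //= [RHS](bigD1 j) //= !eqxx.
  rewrite -!mulrA [_ * (_ \in _)%:R]mulrC mulrA; congr (_ * _).
    by case: (j \in S); rewrite ?mulr1 ?mulr0.
  by apply: eq_bigr => l /negPf ->.
rewrite (bigD1 j) //= eqxx addr0 big1 ?mulr1 // => l /negPf ->.
by ring.
Qed.

Section LatticeZonotope.
Variables (R : realType) (d : nat) (T : seq (ivec d)).

Definition gen (j : 'I_(size T)) : pt R d :=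
  fun i => ((nth [ffun=> 0] T j) i)%:~R.

(** Minus the least value of the i-th coordinate on the zonotope, so that translating by it brings
    this minimum to 0. *)
Definition neg_part_sum (i : 'I_d) : int :=
  \sum_(w <- T) (if w i < 0 then - w i else 0).

Definition zshift : pt R d := fun i => (neg_part_sum i)%:~R.

Lemma translate_zonotopeP t x : translate (zonotope (R:=R) T) t x <->
  exists lam, (forall j, 0 <= lam j <= 1) /\
    x = fun i => t i + \sum_j lam j * gen j i.
Proof.
split=> [[lam [lb h]]|[lam [lb ->]]]; exists lam; split=> //.
  by apply: funext => i; rewrite -h addrC subrK.
by move=> i; rewrite addrAC subrr add0r.
Qed.

Lemma subset_sum_bounds (S : {set 'I_(size T)}) i :
  0 <= neg_part_sum i + \sum_(j in S) (nth [ffun=> 0] T j) i <=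
    (\sum_(w <- T) `|w i|)%N%:Z.
Proof.
have -> : (\sum_(w <- T) `|w i|)%N%:Z = \sum_(w <- T) `|w i|%:Z.
  by rewrite (big_morph Posz PoszD (erefl _)).
rewrite /neg_part_sum !(big_nth [ffun=> 0]) !big_mkord.
rewrite [\sum_(j in S) _]big_mkcond -big_split /=; apply/andP; split.
  by apply: sumr_ge0 => j _; move: (nth _ T j i) => z; case: (j \in S); case: ifP; lia.
by apply: ler_sum => j _; move: (nth _ T j i) => z; case: (j \in S); case: ifP; lia.
Qed.

(** A functional constant on the zonotope agrees on the empty sum and on the generator e_i alone, so
    its i-th entry is 0. The lattice points are the translated subset sums, and [cube_weights] turns
    box coefficients into convex weights on them. *)
Lemma lattice_polytope_zonotope k :
  (forall i : 'I_d, [ffun l => (l == i)%:Z] \in T) ->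
  (forall i, (\sum_(w <- T) `|w i| <= k)%N) ->
  lattice_polytope k (translate (zonotope (R:=R) T) zshift).
Proof.
move=> eT wk; split.
  move=> c [a Ha] i.
  have hb (S : {set 'I_(size T)}) :
      dot c (fun i => zshift i + \sum_j (j \in S)%:R * gen j i) = a.
    apply/Ha/translate_zonotopeP; exists (fun j => (j \in S)%:R); split=> // j.
    by case: (j \in S); rewrite /= ?lexx ?ler01.
  have sub_same (x y z : R) : x + y - (x + z) = y - z by ring.
  have iT : (index [ffun l => (l == i)%:Z] T < size T)%N by rewrite index_mem.
  pose j0 := Ordinal iT.
  have := hb [set j0]; rewrite -(hb set0) => /eqP; rewrite -subr_eq0 /dot -sumrB.
  rewrite (bigD1 i) //= [\sum_(l < d | l != i) _]big1 => [|l li].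
    rewrite addr0 -mulrBr sub_same -sumrB (bigD1 j0) //=.
    rewrite big1 => [|j jj]; last by rewrite !inE (negPf jj) subrr.
    rewrite !inE eqxx mul1r mul0r subr0 addr0 /gen nth_index // ffunE eqxx mulr1.
    by move/eqP.
  rewrite -mulrBr sub_same -sumrB big1 ?mulr0 // => j _.
  rewrite !inE mul0r subr0; case: eqVneq => [->|_]; last by rewrite mul0r.
  by rewrite /gen nth_index // ffunE (negPf li) mulr0.
pose g (S : {set 'I_(size T)}) : ivec d :=
  [ffun i => neg_part_sum i + \sum_(j in S) (nth [ffun=> 0] T j) i].
have gE S i : (g S i)%:~R = zshift i + \sum_j (j \in S)%:R * gen j i :> R.
  rewrite ffunE intrD; congr (_ + _); rewrite big_mkcond /= (big_morph _ (@intrD R) (erefl _)).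
  by apply: eq_bigr => j _; rewrite /gen; case: (j \in S); rewrite ?mul1r ?mul0r.
pose E := index_enum {set 'I_(size T)}.
exists (map g E); split.
  move=> w /mapP [S _ ->] i; rewrite ffunE; have /andP[-> h] := subset_sum_bounds S i.
  by rewrite (le_trans h) // lez_nat.
have nthE (j : 'I_(size (map g E))) : nth [ffun=> 0] (map g E) j = g (nth set0 E j).
  by rewrite (nth_map set0) // -(size_map g).
move=> x; split.
  move=> /translate_zonotopeP [lam [lb ->]].
  have [mu [mu0 mu1 mul]] := cube_weights lb.
  have reidx (F : {set 'I_(size T)} -> R) :
      \sum_(j < size (map g E)) F (nth set0 E j) = \sum_S F S.
    by rewrite -(big_mkord xpredT (fun j => F (nth set0 E j))) size_map -(big_nth set0 xpredT F).
  exists (fun j => mu (nth set0 E j)); split=> //; split; first by rewrite reidx.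
  move=> i; under [RHS]eq_bigr do rewrite nthE.
  rewrite (reidx (fun S => mu S * (g S i)%:~R)).
  under [RHS]eq_bigr do rewrite gE mulrDr mulr_sumr.
  rewrite big_split /= -mulr_suml mu1 mul1r; congr (_ + _).
  rewrite exchange_big /=; apply: eq_bigr => j _.
  by rewrite -mul mulr_suml; apply: eq_bigr => S _; rewrite mulrA.
move=> [mu [mu0 [mu1 h]]]; apply/translate_zonotopeP.
(* Conversely, the coefficient of a generator is the total weight of the subsets containing it. *)
exists (fun l => \sum_j mu j * (l \in nth set0 E j)%:R); split.
  move=> l; rewrite sumr_ge0 /= => [|j _]; last by rewrite mulr_ge0.
  rewrite -[leRHS]mu1; apply: ler_sum => j _; rewrite ler_piMr //.
  by case: (l \in _); rewrite /= ?lexx ?ler01.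
apply: funext => i; rewrite h; under eq_bigr do rewrite nthE gE mulrDr mulr_sumr.
rewrite big_split /= -mulr_suml mu1 mul1r; congr (_ + _).
rewrite exchange_big /=; apply: eq_bigr => l _.
by rewrite mulr_suml; apply: eq_bigr => j _; rewrite mulrA.
Qed.

End LatticeZonotope.

(** * The generators *)

Section Generators.
Variable d : nat.

(* [pvec (i, i)] is e_i; for i < j, [pvec (i, j)] is e_i + e_j and [pvec (j, i)] is
   e_i - e_j. *)
Definition pvec (p : 'I_d * 'I_d) : ivec d :=
  [ffun l => if l == p.2 then 1
             else if l == p.1 then (if (p.1 < p.2)%N then 1 else -1) else 0].

Lemma pvec_diag i : pvec (i, i) = [ffun l => (l == i)%:Z].
Proof. by apply/ffunP => l; rewrite !ffunE /=; case: (l == i). Qed.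

Lemma pvec_abs p l : `|pvec p l|%N = ((l == p.1) || (l == p.2) : nat).
Proof.
by rewrite ffunE; case: (l == p.2); case: (l == p.1); case: (p.1 < p.2)%N.
Qed.

(** Absolute values recover the unordered pair, and the sign at the larger index recovers its
    order. *)
Lemma pvec_inj : injective pvec.
Proof.
have noswap (i j : 'I_d) : (i < j)%N -> pvec (i, j) <> pvec (j, i).
  move=> ij /ffunP/(_ j); rewrite !ffunE /= !eqxx.
  by rewrite ltnNge (ltnW ij) -val_eqE /= gtn_eqF.
move=> [i j] [i' j'] h.
have supp l : ((l == i) || (l == j)) = ((l == i') || (l == j')).
  have := pvec_abs (i, j) l; rewrite h pvec_abs /=.
  by case: (_ || _) => //; case: (_ || _).
have /orP[/eqP Ei|/eqP Ei] : (i == i') || (i == j') by rewrite -supp eqxx.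
  have /orP[/eqP Ej|/eqP Ej] : (j == i') || (j == j') by rewrite -supp eqxx orbT.
    by have := supp j'; rewrite Ei Ej eqxx orbT !orbb => /eqP ->.
  by rewrite Ei Ej.
have /orP[/eqP Ej|/eqP Ej] : (j == i') || (j == j') by rewrite -supp eqxx orbT.
  rewrite {}Ei {}Ej {supp} in h *.
  have [lt|lt|/val_inj ->//] := ltngtP i' j'; first by case: (noswap _ _ lt).
  by case: (noswap _ _ lt).
by have := supp i'; rewrite Ei Ej eqxx orbb /= => /eqP ->.
Qed.

Lemma inG1_pvec p : inG1 (pvec p).
Proof.
split.
  apply: (@leq_trans (\sum_l ((l == p.1) + (l == p.2)))%N).
    by apply: leq_sum => l _; rewrite pvec_abs; case: (l == _); case: (l == _).
  by rewrite big_split /= -!big_mkcond /= !big_pred1_eq.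
split.
  apply/eqP; rewrite -dvdn1; apply: (@biggcdn_inf _ p.2) => //.
  by rewrite pvec_abs eqxx orbT.
case: p => i j; case: (leqP j i) => ij.
  exists j; rewrite ffunE eqxx; split=> // l lj.
  by rewrite ffunE /= -!val_eqE /= !ltn_eqF //; apply: leq_trans ij.
exists i; rewrite ffunE /= eqxx ij; split; first by case: ifP.
move=> l li; by rewrite ffunE /= -!val_eqE /= !ltn_eqF //; apply: ltn_trans ij.
Qed.

(** The leading entry is 1 or 2. If it is 2, the norm bound kills all other entries and the gcd is
    2; so it is 1, and at most one other entry, equal to 1 or -1, remains. *)
Lemma inG1P v : inG1 v <-> exists p, v = pvec p.
Proof.
split=> [[nv [gv [i [vi0 vi]]]]|[p ->]]; last exact: inG1_pvec.
move: nv; rewrite /ivec_norm1 (bigD1 i) //= => nv.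
have [vi1|vi1] := eqVneq (v i) 1; last first.
  have z : (\sum_(l < d | l != i) `|v l| == 0)%N.
    by move: (v i) (\sum_(l < d | l != i) _)%N nv vi0 vi1 => x s; lia.
  move: z; rewrite sum_nat_eq0 => /forallP z.
  suff : (2 %| ivec_gcd v)%N by rewrite gv.
  apply/dvdn_biggcdP => l _; have [->|li] := eqVneq l i.
    by have -> : `|v i|%N = 2%N by move: (v i) nv vi0 vi1 => x; lia.
  by have := z l; rewrite li /= => /eqP ->.
have [/existsP [l /andP[li vl]]|/existsPn h] :=
  boolP [exists l, (l != i) && (v l != 0)]; last first.
  exists (i, i); apply/ffunP => l; rewrite ffunE /=; case: eqVneq => [->//|li].
  by have := h l; rewrite li /= negbK => /eqP.
move: nv; rewrite (bigD1 l) //= => nv.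
have z : (\sum_(m < d | (m != i) && (m != l)) `|v m| == 0)%N.
  by move: (v l) (\sum_(m < d | _) _)%N nv vl => x s; rewrite vi1; lia.
have vl2 : v l = 1 \/ v l = -1 by move: (v l) nv vl => x; rewrite vi1; lia.
move: z; rewrite sum_nat_eq0 => /forallP z.
have il : (i < l)%N.
  rewrite ltn_neqAle eq_sym val_eqE li /= leqNgt; apply/negP => /vi E.
  by rewrite E eqxx in vl.
have vm m : m != i -> m != l -> v m = 0.
  by move=> mi ml; have := z m; rewrite mi ml /= absz_eq0 => /eqP.
have [vl1|vl1] := eqVneq (v l) 1.
  exists (i, l); apply/ffunP => m; rewrite ffunE /= il.
  by case: eqVneq => [->//|ml]; case: eqVneq => [->//|mi]; exact: vm.
exists (l, i); apply/ffunP => m; rewrite ffunE /= ltnNge (ltnW il) /=.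
case: eqVneq => [->//|mi]; case: eqVneq => [->|ml]; last exact: vm.
by case: vl2 => // E; rewrite E in vl1.
Qed.

(** The gcd condition excludes the zero vector, so the first nonzero entry exists and is positive;
    the pairs with [p.2 < p.1] are then exactly those with a negative entry. *)
Lemma inG1plusP v : inG1plus v <-> exists2 p : 'I_d * 'I_d, (p.1 <= p.2)%N & v = pvec p.
Proof.
split=> [[v0 [nv gv]]|[[i j] /= ij ->]]; last first.
  have [h1 [h2 _]] := inG1_pvec (i, j); split=> // l; rewrite ffunE /=.
  case: eqP => // jl; case: eqP => // il; rewrite ifT // ltn_neqAle ij andbT.
  by apply/eqP => /val_inj E; apply: jl; rewrite -E.
have [/existsP[i0 h0]|/existsPn h] := boolP [exists i, v i != 0]; last first.
  move: gv; rewrite /ivec_gcd big1 // => i _.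
  by have := h i; rewrite negbK => /eqP ->.
have /inG1P [[i j] vE] : inG1 v.
  split=> //; split=> //.
  case: (arg_minnP (P := [pred i | v i != 0]) (fun i : 'I_d => i : nat) h0) => i /= vi imin.
  exists i; split; first by rewrite lt_neqAle eq_sym vi v0.
  move=> j ji; apply/eqP; apply: contraTT ji => vj; rewrite -leqNgt; exact: imin.
exists (i, j) => //=; rewrite leqNgt; apply/negP => ji.
have := v0 i; rewrite vE ffunE /= eqxx ltnNge (ltnW ji) -val_eqE /= gtn_eqF //.
Qed.

(** Both leading entries are 1. At distinct positions they kill [a] and [b] in turn; at the same
    position [a = - b], and [v != w] forces [b = 0]. *)
Lemma inG1_indep (R : realDomainType) (v w : ivec d) (a b : R) : inG1 v -> inG1 w -> v != w ->
  (forall l, a * (v l)%:~R + b * (w l)%:~R = 0) -> a = 0 /\ b = 0.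
Proof.
have first_one (u : ivec d) : inG1 u -> exists i, u i = 1 /\ forall j : 'I_d, (j < i)%N -> u j = 0.
  move=> /[dup] [[_ [_ [i [ui uj]]]]] /inG1P [p uE]; exists i; split=> //.
  by have := pvec_abs p i; rewrite -uE; case: (_ || _) => /=; lia.
move=> /first_one [i [vi vj]] /first_one [i' [wi wj]] vw h.
have [ii|ii|/val_inj ii] := ltngtP i i'.
- have := h i; rewrite vi wj // mulr1 mulr0 addr0 => a0; split=> //.
  by have := h i'; rewrite a0 mul0r add0r wi mulr1.
- have := h i'; rewrite wi vj // mulr0 mulr1 add0r => b0; split=> //.
  by have := h i; rewrite b0 mul0r addr0 vi mulr1.
subst i'; have := h i; rewrite vi wi !mulr1 => /eqP; rewrite addr_eq0 => /eqP aE.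
have [b0|b0] := eqVneq b 0; first by rewrite aE b0 oppr0.
case/eqP: vw; apply/ffunP => l; have := h l; rewrite aE mulNr addrC -mulrBr.
move/eqP; rewrite mulf_eq0 (negPf b0) /= -intrB intr_eq0 subr_eq0 => /eqP //.
Qed.

End Generators.

(** * Zonotopes of sets of pairs *)

Section PairZonotope.
Variables (R : realType) (d k : nat) (T : seq (ivec d)) (A : {set 'I_d * 'I_d}).
Hypothesis TA : perm_eq T (map (@pvec d) (enum A)).
Hypothesis diagA : forall i, (i, i) \in A.
Hypothesis degA : forall l, (\sum_j ((l, j) \in A) + \sum_i ((i, l) \in A) <= k.+1)%N.

(** The pairs touching [l] are those in row or column [l]. The loop at [l] is counted in both but
    has width one, which accounts for the successor in [degA]. *)
Lemma pair_width l : (\sum_(w <- T) `|w l| <= k)%N.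
Proof.
rewrite (perm_big _ TA) /= big_map big_enum /=.
rewrite -ltnS; apply: leq_trans (degA l).
rewrite (eq_bigr (fun p : 'I_d * 'I_d => ((l == p.1) || (l == p.2)) : nat)); last first.
  by move=> p _; rewrite pvec_abs.
have -> : (\sum_j ((l, j) \in A) = \sum_(p in A) (l == p.1))%N.
  transitivity (\sum_i \sum_j if (i, j) \in A then (l == i : nat) else 0)%N; last first.
    by rewrite pair_bigA [RHS]big_mkcond; apply: eq_bigr => [[i j]].
  rewrite [RHS](bigD1 l) //= [X in (_ + X)%N]big1 => [|i /negPf il].
    by rewrite addn0; apply: eq_bigr => j _; rewrite eqxx; case: (_ \in _).
  by rewrite big1 // => j _; rewrite eq_sym il; case: ifP.
have -> : (\sum_i ((i, l) \in A) = \sum_(p in A) (l == p.2))%N.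
  transitivity (\sum_i \sum_j if (i, j) \in A then (l == j : nat) else 0)%N; last first.
    by rewrite pair_bigA [RHS]big_mkcond; apply: eq_bigr => [[i j]].
  apply: eq_bigr => i _; rewrite (bigD1 l) //= eqxx big1 => [|j /negPf jl].
    by rewrite addn0; case: (_ \in _).
  by rewrite eq_sym jl; case: ifP.
rewrite -big_split /= (bigD1 (l, l)) //= [leqRHS](bigD1 (l, l)) //= !eqxx /= !add1n !addSn !ltnS.
by apply: leq_sum => p _; case: (l == p.1); case: (l == p.2).
Qed.

Lemma pair_zonotope :
  lattice_polytope k (translate (zonotope (R:=R) T) (@zshift R d T)) /\
  edge_diameter (translate (zonotope (R:=R) T) (@zshift R d T)) #|A|.
Proof.
have memT w : w \in T = (w \in map (@pvec d) (enum A)) by rewrite (perm_mem TA).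
have uT : uniq T by rewrite (perm_uniq TA) (map_inj_uniq (@pvec_inj d)) enum_uniq.
have GT w : w \in T -> inG1 w by rewrite memT => /mapP [p _ ->]; exact: inG1_pvec.
split.
  apply: lattice_polytope_zonotope pair_width => i.
  by rewrite memT -pvec_diag; apply: map_f; rewrite mem_enum.
have -> : #|A| = size T by rewrite (perm_size TA) size_map cardE.
apply: (edge_diameter_zonotope (v := @gen R d T) (t := @zshift R d T)).
- exact: translate_zonotopeP.
- move=> j; have /GT [_ [_ [i [h _]]]] := mem_nth [ffun=> 0] (ltn_ord j).
  by exists i; rewrite /gen intr_eq0 gt_eqF.
move=> i j ij a b; apply: inG1_indep; [exact/GT/mem_nth|exact/GT/mem_nth|].
by rewrite nth_uniq.
Qed.

End PairZonotope.

(** * Sets of pairs with prescribed degrees *)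

Lemma sum_interval (d lo hi : nat) :
  (\sum_(j < d) (lo <= j < hi) = minn hi d - lo)%N.
Proof.
elim: d => [|d IH]; first by rewrite big_ord0 minn0.
by rewrite big_ord_recr /= IH; case: (lo <= d < hi)%N / andP; lia.
Qed.

Lemma card_pairs (d : nat) (A : {set 'I_d * 'I_d}) :
  #|A| = (\sum_i \sum_j ((i, j) \in A))%N.
Proof.
rewrite pair_bigA /= -sum1_card big_mkcond /=; apply: eq_bigr => [[i j]] _ /=.
by case: (_ \in A).
Qed.

(* A circulant digraph with the shifts d - a, ..., d - 1, together with the loops and,
   when [b] holds, the matching {0,1}, {2,3}, ... taken from the unused shift 1. *)
Definition circulant (d a : nat) (b : bool) : {set 'I_d * 'I_d} :=
  [set p : 'I_d * 'I_d | [|| (p.1 == p.2 :> nat), (d - a + p.1 <= p.2)%N, (p.2 < p.1 <= p.2 + a)%N |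
               [&& b, ~~ odd p.1 & p.2 == p.1.+1 :> nat]]].

Section Circulant.
Variables (d a : nat) (b : bool).
Hypothesis ad : (a + b < d)%N.

Let or4_nat (p q r s : bool) : ~~ (p && q) -> ~~ (p && r) -> ~~ (p && s) ->
  ~~ (q && r) -> ~~ (q && s) -> ~~ (r && s) ->
  ([|| p, q, r | s] = p + q + r + s :> nat)%N.
Proof. by case: p q r s => [] [] [] []. Qed.

(** The four clauses are mutually exclusive, so membership can be counted clause by clause. The
    bound [a + b < d] keeps shift 1 out of the range d - a, ..., d - 1 when the matching is
    present. *)
Let circulantE (i j : 'I_d) : (((i, j) \in circulant d a b) =
  (i == j :> nat) + (d - a + i <= j) + (j < i <= j + a) +
  [&& b, ~~ odd i & j == i.+1 :> nat] :> nat)%N.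
Proof.
have ad' : (a < d)%N by apply: leq_trans ad; rewrite ltnS leq_addr.
rewrite inE /=; apply: or4_nat; apply/negP => /andP[].
- by move=> /eqP ->; lia.
- by move=> /eqP -> /andP[]; rewrite ltnn.
- by move=> /eqP -> /and3P[_ _ /eqP]; lia.
- by move=> h /andP[]; lia.
- by move=> h /and3P[bT _ /eqP]; move: ad; rewrite bT => ?; lia.
- by move=> /andP[h _] /and3P[_ _ /eqP]; lia.
Qed.

Let sum_eq (i : nat) : (i < d)%N -> (\sum_(j < d) (i == j) = 1)%N.
Proof.
move=> id; rewrite (eq_bigr (fun j : 'I_d => (i <= j < i.+1 : nat)%N)).
  by rewrite sum_interval (minn_idPl id) subSnn.
by move=> j _; rewrite ltnS -eqn_leq.
Qed.

(** Shifts that do not wrap around contribute max(a - i, 0) and those that wrap min(a, i), together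
    [a]. *)
Lemma circulant_row (i : 'I_d) : (\sum_j ((i, j) \in circulant d a b) =
  a.+1 + [&& b, ~~ odd i & i.+1 < d])%N.
Proof.
have id := ltn_ord i.
under eq_bigr do rewrite circulantE.
rewrite !big_split /= sum_eq //.
have -> : (\sum_(j < d) (d - a + i <= j) = d - (d - a + i))%N.
  transitivity (\sum_(j < d) (d - a + i <= j < d))%N.
    by apply: eq_bigr => j _; rewrite ltn_ord andbT.
  by rewrite sum_interval minnn.
have -> : (\sum_(j < d) (j < i <= j + a) = i - (i - a))%N.
  transitivity (\sum_(j < d) (i - a <= j < i))%N.
    by apply: eq_bigr => j _; rewrite leq_subLR andbC addnC.
  by rewrite sum_interval (minn_idPl (ltnW id)).
have -> : (\sum_(j < d) [&& b, ~~ odd i & j == i.+1 :> nat] =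
    [&& b, ~~ odd i & i.+1 < d])%N.
  case: b => /=; last by rewrite big1.
  case: (odd i) => /=; first by rewrite big1.
  case: (ltnP i.+1 d) => [lt|ge].
    by rewrite -[RHS](sum_eq lt); apply: eq_bigr => j _; rewrite eq_sym.
  by rewrite big1 // => j _; rewrite ltn_eqF // (leq_trans (ltn_ord j)).
have ad' := leq_ltn_trans (leq_addr b a) ad.
by move: [&& b, ~~ odd i & i.+1 < d]%N => c; lia.
Qed.

(** The matching leaves even vertices and enters odd ones, so it adds at most one to the row and
    column of a vertex together. *)
Lemma circulant_col (j : 'I_d) : (\sum_i ((i, j) \in circulant d a b) =
  a.+1 + (b && odd j))%N.
Proof.
have jd := ltn_ord j; have ad' := leq_ltn_trans (leq_addr b a) ad.
under eq_bigr do rewrite circulantE.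
rewrite !big_split /=.
under eq_bigr do rewrite eq_sym.
rewrite sum_eq //.
have -> : (\sum_(i < d) (d - a + i <= j) = j + a.+1 - d)%N.
  transitivity (\sum_(i < d) (0 <= i < j + a.+1 - d))%N.
    by apply: eq_bigr => i _; congr (nat_of_bool _); apply/idP/idP => /=; lia.
  by rewrite sum_interval subn0; apply/minn_idPl; lia.
have -> : (\sum_(i < d) (j < i <= j + a) = minn (j + a).+1 d - j.+1)%N.
  by rewrite -sum_interval.
have -> : (\sum_(i < d) [&& b, ~~ odd i & j == i.+1 :> nat] = (b && odd j))%N.
  case: b => /=; last by rewrite big1.
  case: (posnP j) => [j0|jpos].
    by rewrite j0 big1 // => i _; rewrite andbF.
  have pd : (j.-1 < d)%N by rewrite (leq_ltn_trans (leq_pred j)).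
  rewrite (eq_bigr (fun i : 'I_d => odd j * (j.-1 == i)))%N.
    by rewrite -big_distrr /= sum_eq // muln1.
  move=> i _; rewrite -mulnb -{1 2}(prednK jpos) eqSS /=.
  by case: eqP => [->|_]; rewrite ?muln0 // !muln1.
move: (b && odd j) => c.
by case: (leqP d (j + a).+1) => h; lia.
Qed.

Lemma card_circulant : #|circulant d a b| = ((a.*2 + b + 2) * d %/ 2)%N.
Proof.
rewrite card_pairs; under eq_bigr do rewrite circulant_row.
rewrite big_split /= sum_nat_const card_ord.
have -> : (\sum_(i < d) [&& b, ~~ odd i & i.+1 < d] = b * d./2)%N.
  case: (b); last by rewrite big1.
  clear ad; rewrite mul1n /=; case: d => [|m]; first by rewrite big_ord0.
  (* The last vertex starts no matching pair; the even numbers below d - 1 are floor(d / 2) in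
     number. *)
  transitivity (\sum_(i < m) ~~ odd i)%N.
    rewrite big_ord_recr /= ltnn andbF addn0; apply: eq_bigr => i _ /=.
    by rewrite ltnS ltn_ord andbT.
  elim: m => [|m IH]; first by rewrite big_ord0.
  by rewrite big_ord_recr /= IH; lia.
rewrite divn2; nia.
Qed.

End Circulant.

(** * The extremal family, the positive zonotope and the full zonotope *)

Lemma sum_ltn_leq (d : nat) : (\sum_(i < d) \sum_(j < d) (i <= j) = 'C(d.+1, 2))%N.
Proof.
rewrite exchange_big /=.
rewrite -bin2_sum big_mkord big_ord_recl /= add0n; apply: eq_bigr => j _.
transitivity (\sum_(i < d) (0 <= i < j.+1))%N; first by apply: eq_bigr.
by rewrite sum_interval subn0; have := ltn_ord j; rewrite /bump /=; lia.
Qed.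

Lemma zshift_nonneg (R : realType) (d : nat) (T : seq (ivec d)) :
  (forall w, w \in T -> forall i, 0 <= w i) ->
  translate (zonotope (R:=R) T) (@zshift R d T) = zonotope (R:=R) T.
Proof.
move=> T0; apply: funext => x; rewrite /translate; congr (zonotope _ _).
apply: funext => i; rewrite /zshift /neg_part_sum big1_seq ?subr0 // => w /andP[_ wT].
by rewrite ltNge T0.
Qed.

Theorem theorem3p2 (R : realType) (d k : nat) :
  (0 < d)%N -> (0 < k)%N -> (k <= 2 * d - 1)%N ->
  (* main claim *)
  (exists T : seq (ivec d), uniq T /\ (forall v, v \in T -> inG1 v) /\
     exists t : pt R d,
       lattice_polytope k (translate (zonotope (R:=R) T) t) /\
       edge_diameter (translate (zonotope (R:=R) T) t) ((k + 1) * d %/ 2)%N) /\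
  (* consequence: delta(d,k) >= floor((k+1)d/2) *)
  (forall m : nat,
     (forall (P : pt R d -> Prop) (D : nat),
        lattice_polytope k P -> edge_diameter P D -> (D <= m)%N) ->
     ((k + 1) * d %/ 2 <= m)%N) /\
  (* H_1^+(d,2) is a lattice (d,d)-polytope of edge-diameter binom(d+1,2) *)
  (forall T : seq (ivec d), uniq T -> (forall v, v \in T <-> inG1plus v) ->
     lattice_polytope d (zonotope (R:=R) T) /\
     edge_diameter (zonotope (R:=R) T) 'C(d.+1, 2)) /\
  (* H_1(d,2) is, up to translation, a lattice (d,2d-1)-polytope of edge-diameter d^2 *)
  (forall T : seq (ivec d), uniq T -> (forall v, v \in T <-> inG1 v) ->
     exists t : pt R d,
       lattice_polytope (2 * d - 1) (translate (zonotope (R:=R) T) t) /\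
       edge_diameter (translate (zonotope (R:=R) T) t) (d ^ 2)%N).
Proof.
move=> d0 k0 kd.
have main : exists T : seq (ivec d), uniq T /\ (forall v, v \in T -> inG1 v) /\
     exists t : pt R d,
       lattice_polytope k (translate (zonotope (R:=R) T) t) /\
       edge_diameter (translate (zonotope (R:=R) T) t) ((k + 1) * d %/ 2)%N.
  pose a := k.-1./2; pose b := odd k.-1.
  have kE : k.-1 = (a.*2 + b)%N by rewrite addnC odd_double_half.
  (* From [k <= 2 * d - 1] comes 2a + b <= 2d - 2; for b = 1 parity improves this to a <= d - 2. *)
  have ad : (a + b < d)%N by move: (b) kE => []; lia.
  pose A := circulant d a b.
  exists (map (@pvec d) (enum A)); split.
    by rewrite (map_inj_uniq (@pvec_inj d)) enum_uniq.
  split; first by move=> w /mapP [p _ ->]; exact: inG1_pvec.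
  exists (@zshift R d (map (@pvec d) (enum A))).
  have -> : ((k + 1) * d %/ 2)%N = #|A|.
    by rewrite card_circulant //; congr (_ * _ %/ _)%N; lia.
  apply: pair_zonotope => // [i|l]; first by rewrite inE /= eqxx.
  rewrite circulant_row // circulant_col //.
  by move: (b) kE => [] kE; case: (odd l) => /=; lia.
split=> //; split.
  by case: main => T [_ [_ [t [h1 h2]]]] m h; exact: h h1 h2.
split=> T uT TG.
  (* Row [l] has d - l pairs and column [l] has l + 1, in total d + 1, as required for k = d. *)
  pose A := [set p : 'I_d * 'I_d | (p.1 <= p.2)%N].
  rewrite -(@zshift_nonneg R d T) => [|w /TG [] //].
  have -> : 'C(d.+1, 2) = #|A|.
    rewrite card_pairs -sum_ltn_leq; apply: eq_bigr => i _; apply: eq_bigr => j _.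
    by rewrite inE.
  apply: pair_zonotope => [|i|l].
  - apply: uniq_perm => //; first by rewrite (map_inj_uniq (@pvec_inj d)) enum_uniq.
    move=> w; apply/idP/mapP => [/TG/inG1plusP [p ple ->]|[p]].
      by exists p => //; rewrite mem_enum inE.
    by rewrite mem_enum inE => ple ->; apply/TG/inG1plusP; exists p.
  - by rewrite inE.
  have -> : (\sum_j ((l, j) \in A) = \sum_(j < d) (l <= j < d))%N.
    by apply: eq_bigr => j _; rewrite inE ltn_ord andbT.
  have -> : (\sum_i ((i, l) \in A) = \sum_(i < d) (0 <= i < l.+1))%N.
    by apply: eq_bigr => i _; rewrite inE.
  by rewrite !sum_interval; have := ltn_ord l; lia.
exists (@zshift R d T).
(* All pairs are taken: rows and columns have d elements each, and 2d is the successor of 2d - 1. *)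
have -> : (d ^ 2 = #|[set: 'I_d * 'I_d]|)%N by rewrite cardsT card_prod card_ord mulnn.
apply: pair_zonotope => [|i|l].
- apply: uniq_perm => //; first by rewrite (map_inj_uniq (@pvec_inj d)) enum_uniq.
  move=> w; apply/idP/mapP => [/TG/inG1P [p ->]|[p _ ->]].
    by exists p => //; rewrite mem_enum inE.
  by apply/TG; exact: inG1_pvec.
- by rewrite inE.
under eq_bigr do rewrite inE.
under [X in (_ + X)%N]eq_bigr do rewrite inE.
by rewrite !sum_nat_const card_ord; lia.
Qed.
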